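(* Let $\mathbb{F}$ be a field and let $(\mathsf{P},\mu,\eta)$ be the reduced power series monad on the category $\mathbb{F}\text{-}\mathsf{VEC}$ of $\mathbb{F}$-vector spaces. Then the maps $\partial_V:\mathsf{P}(V)\to\mathsf{P}(V\times V)$ given, for $\mathfrak{t}=(\mathfrak{t}(n))_{n\ge1}$ with $\mathfrak{t}(n)=\sum_{i=1}^m v_{(n,i,1)}\cdots v_{(n,i,n)}$, by $$\partial_V(\mathfrak{t})(n)=\sum_{i=1}^m\sum_{j=1}^n\Big(\prod_{k\neq j}(v_{(n,i,k)},0)\Big)(0,v_{(n,i,j)})$$ form a differential combinator transformation on the monad $(\mathsf{P},\mu,\eta)$.
   Context: The monad $\mathsf{P}$. For an $\mathbb{F}$-vector space $V$, $\mathsf{P}(V)=\prod_{n=1}^\infty (V^{\otimes n})_{S(n)}$, where $(V^{\otimes n})_{S(n)}$ is the space of coinvariants of $V^{\otimes n}$ under the symmetric group $S(n)$ permuting factors; $v_1\cdots v_n$ denotes the class of $v_1\otimes\cdots\otimes v_n$. An element is a sequence $\mathfrak{t}=(\mathfrak{t}(n))_{n\ge1}$ with $\mathfrak{t}(n)\in(V^{\otimes n})_{S(n)}$, and each $\mathfrak{t}(n)$ is a finite sum $\sum_{i=1}^m v_{(n,i,1)}\cdots v_{(n,i,n)}$. Concatenation induces the commutative associative product $*:(V^{\otimes n})_{S(n)}\otimes(V^{\otimes k})_{S(k)}\to(V^{\otimes n+k})_{S(n+k)}$; juxtaposition and $\prod$ denote such products. For linear $f:V\to W$, $\mathsf{P}(f)(\mathfrak{t})(n)=\sum_i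 f(v_{(n,i,1)})\cdots f(v_{(n,i,n)})$. The unit is $\eta_V(v)=(v,0,0,\dots)$. For $\mathfrak{s}\in\mathsf{P}\mathsf{P}(V)$ with $\mathfrak{s}(k)=\sum_{i=1}^m\mathfrak{s}(k)_{(i,1)}\cdots\mathfrak{s}(k)_{(i,k)}$, $\mathfrak{s}(k)_{(i,j)}\in\mathsf{P}(V)$, and for $n_1+\dots+n_k=n$ with all $n_j\ge1$, put $\mathfrak{s}(n_1,\dots,n_k)=\sum_{i=1}^m\mathfrak{s}(k)_{(i,1)}(n_1)*\cdots*\mathfrak{s}(k)_{(i,k)}(n_k)$. The multiplication is $\mu_V(\mathfrak{s})(n)=\sum_{k=1}^n\sum_{n_1+\dots+n_k=n}\mathfrak{s}(n_1,\dots,n_k)$, the inner sum over ordered tuples of positive integers. It is known that $(\mathsf{P},\mu,\eta)$ is a monad on $\mathbb{F}\text{-}\mathsf{VEC}$. Differential combinator transformations on monads. Let $(\mathsf{S},\mu,\eta)$ be a monad on a category with finite biproducts $\times$, with projections $\pi_0,\pi_1$, injections $\iota_0,\iota_1$, diagonal $\Delta_V=\langle 1_V,1_V\rangle:V\to V\times V$, and copairing $[-,-]$. Let $c_V=\langle\pi_0\times\pi_0,\pi_1\times\pi_1\rangle:(V\times V)\times(V\times V)\to(V\times V)\times(V\times V)$. A differential combinator transformation on $(\mathsf{S},\mu,\eta)$ is a natural transformation $\partial_V:\mathsf{S}(V)\to\mathsf{S}(V\times V)$ such that: [dc.1] $\mathsf{S}(\pi_0)\circ\partial_V=0$; [dc.2]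 $\mathsf{S}(1_V\times\Delta_V)\circ\partial_V=(\mathsf{S}(1_V\times\iota_0)+\mathsf{S}(1_V\times\iota_1))\circ\partial_V$; [dc.3] $\partial_V\circ\eta_V=\eta_{V\times V}\circ\iota_1$; [dc.4] $\partial_V\circ\mu_V=\mu_{V\times V}\circ\mathsf{S}([\mathsf{S}(\iota_0),\partial_V])\circ\partial_{\mathsf{S}(V)}$; [dc.5] $\mathsf{S}(\pi_0\times\pi_1)\circ\partial_{V\times V}\circ\partial_V=\partial_V$; [dc.6] $\mathsf{S}(c_V)\circ\partial_{V\times V}\circ\partial_V=\partial_{V\times V}\circ\partial_V$. (This is the dual of the notion of differential combinator transformation on a comonad.) *)

(* Defs.v *)
From HB Require Import structures.
From mathcomp Require Import all_boot perm ssralg ring_quotient generic_quotient.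
From mathcomp Require Import boolp freeg.

Set Implicit Arguments.
Unset Strict Implicit.
Unset Printing Implicit Defensive.

Import GRing.Theory.
Local Open Scope ring_scope.
Local Open Scope quotient_scope.

Section LinearMap.
Variables (F : fieldType) (U V : lmodType F) (f : U -> V).

Definition linear_map_fun of linear f := f.

HB.instance Definition _ (Hf : linear f) :=
  GRing.isLinear.Build F U V *:%R (linear_map_fun Hf) Hf.

Definition linear_map (Hf : linear f) : {linear U -> V} := linear_map_fun Hf.

Lemma linear_mapE (Hf : linear f) x : linear_map Hf x = f x.
Proof. by []. Qed.
End LinearMap.

Section Span.
Variables (F : fieldType) (W : lmodType F) (G : W -> Prop).

Inductive span : W -> Prop :=
| span_gen x : G x -> span x
| span_zero : span 0
| span_add x y : span x -> span y -> span (x + y)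
| span_scale a x : span x -> span (a *: x).

Definition span_pred : {pred W} := fun x => `[< span x >].

Lemma span_predP x : reflect (span x) (x \in span_pred).
Proof. exact: asboolP. Qed.

Lemma span_pred_zmod : zmod_closed span_pred.
Proof.
split=> [|x y /span_predP sx /span_predP sy]; first exact/span_predP/span_zero.
by apply/span_predP; rewrite -scaleN1r; apply/span_add/span_scale.
Qed.

HB.instance Definition _ := GRing.isZmodClosed.Build W span_pred span_pred_zmod.

Definition span_quot : Type := Quotient.quot span_pred.

HB.instance Definition _ := GRing.Zmodule.on span_quot.
HB.instance Definition _ := EqQuotient.on span_quot.

Lemma span_quot_eqP x y : \pi_span_quot x = \pi_span_quot y <-> span (x - y).
Proof.
split=> [/eqP|s]; first by rewrite -Quotient.idealrBE => /span_predP.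
by apply/eqP; rewrite -Quotient.idealrBE; apply/span_predP.
Qed.

Lemma span_quot_piD x y : \pi_span_quot (x + y) = \pi_span_quot x + \pi_span_quot y :> span_quot.
Proof. exact: Quotient.pi_add. Qed.

Definition span_quot_scale a (x : span_quot) : span_quot := \pi_span_quot (a *: repr x).

Lemma span_quot_piZ a x : \pi_span_quot (a *: x) = span_quot_scale a (\pi_span_quot x) :> span_quot.
Proof.
apply/span_quot_eqP; rewrite -scalerBr; apply/span_scale/span_quot_eqP.
by rewrite reprK.
Qed.

Lemma span_quot_scaleA a b x :
  span_quot_scale a (span_quot_scale b x) = span_quot_scale (a * b) x.
Proof. by elim/quotW: x => x; rewrite -[RHS]span_quot_piZ -scalerA !span_quot_piZ. Qed.

Lemma span_quot_scale1 : left_id 1 span_quot_scale.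
Proof. by elim/quotW=> x; rewrite -[LHS]span_quot_piZ scale1r. Qed.

Lemma span_quot_scaleDr : right_distributive span_quot_scale +%R.
Proof.
move=> a; elim/quotW=> x; elim/quotW=> y.
by rewrite -span_quot_piD -[LHS]span_quot_piZ scalerDr span_quot_piD !span_quot_piZ.
Qed.

Lemma span_quot_scaleDl x : {morph span_quot_scale^~ x : a b / a + b}.
Proof.
by elim/quotW: x => x a b; rewrite -[LHS]span_quot_piZ scalerDl span_quot_piD !span_quot_piZ.
Qed.

HB.instance Definition _ := GRing.Zmodule_isLmodule.Build F span_quot
  span_quot_scaleA span_quot_scale1 span_quot_scaleDr span_quot_scaleDl.

Definition span_proj_fun (x : W) : span_quot := \pi_span_quot x.

Lemma span_proj_linear : linear span_proj_fun.
Proof. by move=> a x y; rewrite /span_proj_fun span_quot_piD span_quot_piZ. Qed.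

(* The quotient is opaque so that conversion never unfolds its construction. *)
Lemma lquot_exists : {Q : lmodType F & {p : {linear W -> Q} |
  (forall y, exists x, p x = y) /\ (forall x, p x = 0 <-> span x)}}.
Proof.
exists span_quot, (linear_map span_proj_linear); split=> [|x].
  by elim/quotW => x; exists x.
rewrite -(linear0 (linear_map span_proj_linear)).
by rewrite [_ = _]span_quot_eqP subr0.
Qed.

Definition lquot : lmodType F := projT1 lquot_exists.

Definition lproj : {linear W -> lquot} := sval (projT2 lquot_exists).

Lemma lproj_surj y : exists x, lproj x = y.
Proof. by case: (svalP (projT2 lquot_exists)) => + _; apply. Qed.

Lemma lproj_eq0P x : lproj x = 0 <-> span x.
Proof. by case: (svalP (projT2 lquot_exists)) => _; apply. Qed.

Lemma lproj_eqP x y : lproj x = lproj y <-> span (x - y).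
Proof.
rewrite -lproj_eq0P linearB; split=> [->|/eqP]; first exact: subrr.
by rewrite subr_eq0 => /eqP.
Qed.

Lemma lprojW (P : lquot -> Prop) : (forall x, P (lproj x)) -> forall x, P x.
Proof. by move=> PP y; case: (lproj_surj y) => x <-. Qed.

Section Lift.
Variables (U : lmodType F) (f : {linear W -> U}).
Hypothesis f0 : forall x, G x -> f x = 0.

Lemma lquot_lift_exists :
  {g : {linear lquot -> U} | forall x, g (lproj x) = f x}.
Proof.
pose g y := f (sval (cid (lproj_surj y))).
have span0 y : span y -> f y = 0.
  elim=> {y}[y /f0 //||y z _ fy _ fz|a y _ fy]; first exact: linear0.
    by rewrite linearD fy fz addr0.
  by rewrite linearZ fy /= scaler0.
have gE x : g (lproj x) = f x.
  rewrite /g; case: cid => z /= /lproj_eqP/span0/eqP.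
  by rewrite linearB subr_eq0 => /eqP.
have gL : linear g.
  move=> a; elim/lprojW=> x; elim/lprojW=> y.
  by rewrite -linearP !gE linearP.
by exists (linear_map gL).
Qed.

Definition lquot_lift : {linear lquot -> U} := sval lquot_lift_exists.

Lemma lquot_liftE x : lquot_lift (lproj x) = f x.
Proof. exact: (svalP lquot_lift_exists). Qed.
End Lift.
End Span.

Arguments lquot {F W} G.
Arguments lproj {F W} G.

Section FreeModule.
Variables (F : fieldType) (K : choiceType).

Definition free_gen (k : K) : {freeg K / F} := << k >>.

Lemma free_ind (P : {freeg K / F} -> Prop) :
  (forall k, P (free_gen k)) -> P 0 -> (forall x y, P x -> P y -> P (x + y)) ->
  (forall a x, P x -> P (a *: x)) -> forall x, P x.
Proof.
move=> Pg P0 PD PZ x; rewrite -[x]freeg_sumE.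
apply: big_ind => // k _; suff -> : << coeff k x *g k >> = coeff k x *: free_gen k.
  exact: PZ.
by apply/eqP/freeg_eqP => l; rewrite coeffZ !coeffU mul1r.
Qed.

Variables (U : lmodType F) (f : K -> U).

Lemma free_lift_linear : linear (fglift f).
Proof.
have fD : {morph fglift f : x y / x + y}.
  move=> x y; apply/eqP; rewrite -subr_eq -{2}[x](addrK y).
  by apply/eqP/esym/lift_is_additive.
have f0 : fglift f 0 = 0 by apply: (@addrI _ (fglift f 0)); rewrite -fD !addr0.
have fZ a x : fglift f (a *: x) = a *: fglift f x.
  rewrite -[x]freeg_sumE scaler_sumr.
  elim/big_ind2: _ => [|x1 y1 x2 y2 e1 e2|k _].
  - by rewrite f0 scaler0.
  - by rewrite !fD e1 e2 scalerDr.
  - suff -> : a *: << coeff k x *g k >> = << a * coeff k x *g k >>.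
      by rewrite !liftU scalerA.
    by apply/eqP/freeg_eqP => l; rewrite coeffZ !coeffU mulrA.
by move=> a x y; rewrite fD fZ.
Qed.

Definition free_lift : {linear {freeg K / F} -> U} := linear_map free_lift_linear.

Lemma free_liftE k : free_lift (free_gen k) = f k.
Proof. by rewrite linear_mapE liftU scale1r. Qed.
End FreeModule.

Section DirectProduct.
Variables (F : fieldType) (I : Type) (M : I -> lmodType F).

Definition dprod : Type := forall i, M i.

HB.instance Definition _ := gen_eqMixin dprod.
HB.instance Definition _ := gen_choiceMixin dprod.

Implicit Types x y z : dprod.

Definition dprod_zero : dprod := fun=> 0.
Definition dprod_opp x : dprod := fun i => - x i.
Definition dprod_add x y : dprod := fun i => x i + y i.
Definition dprod_scale a x : dprod := fun i => a *: x i.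

Lemma dprodP x y : (forall i, x i = y i) -> x = y.
Proof. exact: functional_extensionality_dep. Qed.

Lemma dprod_addA : associative dprod_add.
Proof. by move=> x y z; apply: dprodP => i; apply: addrA. Qed.

Lemma dprod_addC : commutative dprod_add.
Proof. by move=> x y; apply: dprodP => i; apply: addrC. Qed.

Lemma dprod_add0 : left_id dprod_zero dprod_add.
Proof. by move=> x; apply: dprodP => i; apply: add0r. Qed.

Lemma dprod_addN : left_inverse dprod_zero dprod_opp dprod_add.
Proof. by move=> x; apply: dprodP => i; apply: addNr. Qed.

HB.instance Definition _ :=
  GRing.isZmodule.Build dprod dprod_addA dprod_addC dprod_add0 dprod_addN.

Lemma dprod_scaleA a b x :
  dprod_scale a (dprod_scale b x) = dprod_scale (a * b) x.
Proof. by apply: dprodP => i; apply: scalerA. Qed.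

Lemma dprod_scale1 : left_id 1 dprod_scale.
Proof. by move=> x; apply: dprodP => i; apply: scale1r. Qed.

Lemma dprod_scaleDr : right_distributive dprod_scale +%R.
Proof. by move=> a x y; apply: dprodP => i; apply: scalerDr. Qed.

Lemma dprod_scaleDl x : {morph dprod_scale^~ x : a b / a + b}.
Proof. by move=> a b; apply: dprodP => i; apply: scalerDl. Qed.

HB.instance Definition _ := GRing.Zmodule_isLmodule.Build F dprod
  dprod_scaleA dprod_scale1 dprod_scaleDr dprod_scaleDl.

Lemma dprodDE x y i : (x + y) i = x i + y i. Proof. by []. Qed.
Lemma dprodZE a x i : (a *: x) i = a *: x i. Proof. by []. Qed.
Lemma dprod0E i : (0 : dprod) i = 0. Proof. by []. Qed.

Lemma dprod_sumE (J : Type) (r : seq J) (P : pred J) (f : J -> dprod) i :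
  (\sum_(j <- r | P j) f j) i = \sum_(j <- r | P j) f j i.
Proof. by elim/big_rec2: _ => // j y1 y2 _ <-. Qed.
End DirectProduct.

Section TensorPower.
Variables (F : fieldType) (V : lmodType F) (n : nat).
Implicit Types (v w : n.-tuple V) (s : 'S_n).

Definition tuple_upd v (j : 'I_n) (x : V) : n.-tuple V :=
  [tuple if i == j then x else tnth v i | i < n].

Definition tuple_perm v s : n.-tuple V := [tuple tnth v (s i) | i < n].

Definition multilinear (U : lmodType F) (f : n.-tuple V -> U) :=
  forall v j a x y, f (tuple_upd v j (a *: x + y)) =
    a *: f (tuple_upd v j x) + f (tuple_upd v j y).

Definition symmetric_fun (U : Type) (f : n.-tuple V -> U) :=
  forall v s, f (tuple_perm v s) = f v.

Definition tensor_rel (r : {freeg (n.-tuple V) / F}) :=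
  exists v j a x y, r = free_gen F (tuple_upd v j (a *: x + y)) -
    (a *: free_gen F (tuple_upd v j x) + free_gen F (tuple_upd v j y)).

Definition tpow : lmodType F := lquot tensor_rel.

Definition tens v : tpow := lproj tensor_rel (free_gen F v).

Lemma tens_multilinear : multilinear tens.
Proof.
move=> v j a x y; rewrite -linearP; apply/lproj_eqP/span_gen.
by exists v, j, a, x, y.
Qed.

Lemma tpow_ind (P : tpow -> Prop) :
  (forall v, P (tens v)) -> P 0 -> (forall x y, P x -> P y -> P (x + y)) ->
  (forall a x, P x -> P (a *: x)) -> forall x, P x.
Proof.
move=> Pg P0 PD PZ; apply: lprojW; apply: free_ind => //.
- by rewrite linear0.
- by move=> x y Px Py; rewrite linearD; apply: PD.
- by move=> a x Px; rewrite linearZ; apply: PZ.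
Qed.

Section Lift.
Variables (U : lmodType F) (f : n.-tuple V -> U).
Hypothesis f_multilinear : multilinear f.

Lemma tensor_lift_rel r : tensor_rel r -> free_lift f r = 0.
Proof.
case=> [v [j [a [x [y ->]]]]].
by rewrite linearB linearP /= !free_liftE f_multilinear subrr.
Qed.

Definition tensor_lift : {linear tpow -> U} := lquot_lift tensor_lift_rel.

Lemma tensor_liftE v : tensor_lift (tens v) = f v.
Proof. by rewrite /tensor_lift lquot_liftE free_liftE. Qed.
End Lift.

Lemma tuple_upd_perm v s j x :
  tuple_perm (tuple_upd v (s j) x) s = tuple_upd (tuple_perm v s) j x.
Proof.
by apply: eq_from_tnth => i; rewrite !tnth_mktuple (inj_eq perm_inj).
Qed.

Lemma multilinear_perm (U : lmodType F) (f : n.-tuple V -> U) s :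
  multilinear f -> multilinear (fun v => f (tuple_perm v s)).
Proof.
move=> fM v j a x y; pose w := tuple_perm v s.
have E z : tuple_perm (tuple_upd v j z) s = tuple_upd w (s^-1%g j) z.
  by rewrite -tuple_upd_perm permKV.
by rewrite !E fM.
Qed.

Definition tensor_perm s : {linear tpow -> tpow} :=
  tensor_lift (multilinear_perm s tens_multilinear).

Definition coinvariant_rel (r : tpow) := exists s x, r = tensor_perm s x - x.

Definition sympow : lmodType F := lquot coinvariant_rel.

(* The class [v_1 ... v_n] of the tensor of the v_i. *)
Definition sprod v : sympow := lproj coinvariant_rel (tens v).

Lemma sprod_multilinear : multilinear sprod.
Proof. by move=> v j a x y; rewrite /sprod tens_multilinear linearP. Qed.

Lemma sprod_symmetric : symmetric_fun sprod.
Proof.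
move=> v s; apply/lproj_eqP/span_gen; exists s, (tens v).
by rewrite tensor_liftE.
Qed.

Lemma sprod_perm_eq v w : perm_eq v w -> sprod v = sprod w.
Proof.
case/tuple_permP=> s vE; rewrite -[RHS](sprod_symmetric w s).
by congr sprod; apply: val_inj.
Qed.

Lemma sympow_ind (P : sympow -> Prop) :
  (forall v, P (sprod v)) -> P 0 -> (forall x y, P x -> P y -> P (x + y)) ->
  (forall a x, P x -> P (a *: x)) -> forall x, P x.
Proof.
move=> Pg P0 PD PZ; apply: lprojW; apply: tpow_ind => //.
- by rewrite linear0.
- by move=> x y Px Py; rewrite linearD; apply: PD.
- by move=> a x Px; rewrite linearZ; apply: PZ.
Qed.

Lemma sympow_linear_eq (U : lmodType F) (f g : {linear sympow -> U}) :
  (forall v, f (sprod v) = g (sprod v)) -> f =1 g.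
Proof.
move=> fg; apply: sympow_ind => //; first by rewrite !linear0.
  by move=> x y fx fy; rewrite !linearD fx fy.
by move=> a x fx; rewrite !linearZ fx.
Qed.

Lemma sympow_sum (x : sympow) : (0 < n)%N ->
  exists m (v : 'I_m -> n.-tuple V), x = \sum_(i < m) sprod (v i).
Proof.
move=> n0; suff [s ->] : exists s : seq (n.-tuple V), x = \sum_(v <- s) sprod v.
  by exists (size s), (tnth (in_tuple s)); rewrite big_tnth.
elim/sympow_ind: x => [v||_ _ [s ->] [t ->]|a _ [s ->]].
- by exists [:: v]; rewrite big_seq1.
- by exists [::]; rewrite big_nil.
- by exists (s ++ t); rewrite big_cat.
pose j := Ordinal n0; exists [seq tuple_upd v j (a *: tnth v j) | v <- s].
rewrite scaler_sumr big_map; apply: eq_bigr => v _.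
have E z : tuple_upd v j (z *: tnth v j) =
           tuple_upd v j (z *: tnth v j + (0 : V)) by rewrite addr0.
have S0 : sprod (tuple_upd v j 0) = 0.
  have := sprod_multilinear v j 1 0 0.
  rewrite !scale1r addr0 => /(congr1 (fun u => u - sprod (tuple_upd v j 0))).
  by rewrite subrr addrK.
rewrite E sprod_multilinear S0 addr0; congr (_ *: sprod _).
by apply: eq_from_tnth => i; rewrite tnth_mktuple; case: eqP => [->|].
Qed.

Section SymLift.
Variables (U : lmodType F) (f : n.-tuple V -> U).
Hypotheses (f_multilinear : multilinear f) (f_symmetric : symmetric_fun f).

Lemma sym_lift_rel r : coinvariant_rel r -> tensor_lift f_multilinear r = 0.
Proof.
case=> s [x ->] {r}; rewrite linearB; apply/eqP; rewrite subr_eq0; apply/eqP.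
elim/tpow_ind: x => [v||x y ex ey|a x ex].
- by rewrite !tensor_liftE f_symmetric.
- by rewrite !linear0.
- by rewrite !linearD ex ey.
- by rewrite !linearZ ex.
Qed.

Definition sym_lift : {linear sympow -> U} := lquot_lift sym_lift_rel.

Lemma sym_liftE v : sym_lift (sprod v) = f v.
Proof. by rewrite /sym_lift lquot_liftE tensor_liftE. Qed.
End SymLift.
End TensorPower.

Arguments sympow {F} V n.
Arguments tpow {F} V n.

Section SymmetricProduct.
Variables (F : fieldType) (V : lmodType F).

Lemma cat_tuple_updl a b (v : a.-tuple V) (w : b.-tuple V) j x :
  cat_tuple (tuple_upd v j x) w = tuple_upd (cat_tuple v w) (lshift b j) x.
Proof.
apply: eq_from_tnth => i; rewrite [RHS]tnth_mktuple.
case: (split_ordP i) => k ->; rewrite ?tnth_lshift ?tnth_rshift.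
  by rewrite tnth_mktuple eq_lshift.
by rewrite eq_rlshift.
Qed.

Lemma cat_tuple_updr a b (v : a.-tuple V) (w : b.-tuple V) j x :
  cat_tuple v (tuple_upd w j x) = tuple_upd (cat_tuple v w) (rshift a j) x.
Proof.
apply: eq_from_tnth => i; rewrite [RHS]tnth_mktuple.
case: (split_ordP i) => k ->; rewrite ?tnth_lshift ?tnth_rshift.
  by rewrite eq_lrshift.
by rewrite tnth_mktuple eq_rshift.
Qed.

Lemma perm_eq_tuple_perm n (v : n.-tuple V) s : perm_eq (tuple_perm v s) v.
Proof. by apply/tuple_permP; exists s. Qed.

Section Mul.
Variables a b : nat.

Lemma sprod_catl_multilinear (w : b.-tuple V) :
  multilinear (fun v : a.-tuple V => sprod (cat_tuple v w)).
Proof. by move=> v j c x y; rewrite !cat_tuple_updl sprod_multilinear. Qed.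

Lemma sprod_catl_symmetric (w : b.-tuple V) :
  symmetric_fun (fun v : a.-tuple V => sprod (cat_tuple v w)).
Proof.
by move=> v s; apply: sprod_perm_eq; rewrite perm_cat2r perm_eq_tuple_perm.
Qed.

Definition sprod_catl w : {linear sympow V a -> sympow V (a + b)} :=
  sym_lift (sprod_catl_multilinear w) (sprod_catl_symmetric w).

Lemma sprod_catl_mulr_multilinear x : multilinear (sprod_catl^~ x).
Proof.
move=> w j c y z /=; elim/sympow_ind: x => [v||x1 x2 e1 e2|d x e].
- by rewrite !sym_liftE !cat_tuple_updr sprod_multilinear.
- by rewrite !linear0 ?scaler0 addr0.
- by rewrite !(linearD (sprod_catl _)) e1 e2 scalerDr addrACA.
- by rewrite !(linearZ_LR (sprod_catl _)) e scalerDr !scalerA mulrC.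
Qed.

Lemma sprod_catl_mulr_symmetric x : symmetric_fun (sprod_catl^~ x).
Proof.
move=> w s /=; elim/sympow_ind: x => [v||x1 x2 e1 e2|d x e].
- rewrite !sym_liftE; apply: sprod_perm_eq.
  by rewrite perm_cat2l perm_eq_tuple_perm.
- by rewrite !linear0.
- by rewrite !linearD e1 e2.
- by rewrite !linearZ e.
Qed.

Definition sym_mul (x : sympow V a) : {linear sympow V b -> sympow V (a + b)} :=
  sym_lift (sprod_catl_mulr_multilinear x) (sprod_catl_mulr_symmetric x).

Lemma sym_mulE v w : sym_mul (sprod v) (sprod w) = sprod (cat_tuple v w).
Proof. by rewrite !sym_liftE. Qed.

Lemma sym_mul_linearl y : linear (sym_mul^~ y).
Proof.
move=> c x1 x2 /=; elim/sympow_ind: y => [w||y1 y2 e1 e2|d y e].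
- by rewrite !sym_liftE linearP.
- by rewrite !linear0 ?scaler0 addr0.
- by rewrite !(linearD (sym_mul _)) e1 e2 scalerDr addrACA.
- by rewrite !(linearZ_LR (sym_mul _)) e scalerDr !scalerA mulrC.
Qed.
End Mul.

Arguments sym_mul {a b} x.

(* Transport along [m = n]; only ever applied in that case. *)
Definition sym_cast m n (x : sympow V m) : sympow V n :=
  if @eqP _ m n is ReflectT e then ecast k (sympow V k) e x else 0.

Lemma sym_cast_linear m n : linear (@sym_cast m n).
Proof.
rewrite /sym_cast => c x y; case: eqP => [e|_]; last by rewrite scaler0 addr0.
by case: n / e.
Qed.

Lemma sym_cast_id n (x : sympow V n) : sym_cast n x = x.
Proof. by rewrite /sym_cast; case: eqP => // e; rewrite eq_axiomK. Qed.

Lemma sym_cast_neq m n (x : sympow V m) : m <> n -> sym_cast n x = 0.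
Proof. by rewrite /sym_cast; case: eqP. Qed.

Definition sprod_seq n (s : seq V) : sympow V n :=
  if insub s is Some t then sprod t else 0.

Lemma sprod_seq_tuple n (v : n.-tuple V) : sprod_seq n v = sprod v.
Proof. by rewrite /sprod_seq valK. Qed.

Lemma sprod_seq_neq n s : size s != n -> sprod_seq n s = 0.
Proof. by move=> ne; rewrite /sprod_seq insubN. Qed.

Lemma sprod_seq_perm n s t : perm_eq s t -> sprod_seq n s = sprod_seq n t.
Proof.
move=> st; have [e|ne] := eqVneq (size s) n; last first.
  by rewrite !sprod_seq_neq // -(perm_size st).
have e' : size t == n by rewrite -(perm_size st) e.
rewrite -[s]/(val (Tuple (introT eqP e))) -[t]/(val (Tuple e')).
by rewrite !sprod_seq_tuple; apply: sprod_perm_eq.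
Qed.

Lemma sym_cast_sprod m n (v : m.-tuple V) : sym_cast n (sprod v) = sprod_seq n v.
Proof.
have [e|/eqP ne] := eqVneq m n.
  by case: n / e; rewrite sym_cast_id sprod_seq_tuple.
by rewrite sym_cast_neq // sprod_seq_neq // size_tuple; apply/eqP.
Qed.

Definition hmul n a b (x : sympow V a) (y : sympow V b) : sympow V n :=
  sym_cast n (sym_mul x y).

Lemma hmul_linearl n a b y : linear (fun x => @hmul n a b x y).
Proof.
move=> c x1 x2; rewrite /hmul -[RHS]sym_cast_linear; congr sym_cast.
exact: sym_mul_linearl.
Qed.

Lemma hmul_linearr n a b x : linear (@hmul n a b x).
Proof.
by move=> c y1 y2; rewrite /hmul -[RHS]sym_cast_linear linearP.
Qed.

HB.instance Definition _ n a b x :=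
  GRing.isLinear.Build F (sympow V b) (sympow V n) *:%R (@hmul n a b x)
    (@hmul_linearr n a b x).

Definition hmulr n a b y : {linear sympow V a -> sympow V n} :=
  linear_map (@hmul_linearl n a b y).

Lemma hmulDl n a b (x x' : sympow V a) (y : sympow V b) :
  hmul n (x + x') y = hmul n x y + hmul n x' y.
Proof. exact: linearD (hmulr n a y) _ _. Qed.

Lemma hmulZl n a b c (x : sympow V a) (y : sympow V b) :
  hmul n (c *: x) y = c *: hmul n x y.
Proof. exact: linearZ_LR (hmulr n a y) _ _. Qed.

Lemma hmul0l n a b (y : sympow V b) : hmul n (0 : sympow V a) y = 0.
Proof. exact: linear0 (hmulr n a y). Qed.

Lemma hmul_suml n a b I (r : seq I) (P : pred I) (f : I -> sympow V a)
    (y : sympow V b) :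
  hmul n (\sum_(i <- r | P i) f i) y = \sum_(i <- r | P i) hmul n (f i) y.
Proof. exact: raddf_sum (hmulr n a y) _ _ _ _. Qed.

Lemma hmul_neq n a b (x : sympow V a) (y : sympow V b) :
  (a + b)%N <> n -> hmul n x y = 0.
Proof. exact: sym_cast_neq. Qed.

Lemma hmul_sprod n a b (v : a.-tuple V) (w : b.-tuple V) :
  hmul n (sprod v) (sprod w) = sprod_seq n (v ++ w).
Proof. by rewrite /hmul sym_mulE sym_cast_sprod. Qed.

Lemma hmul_sprod_seq n a b s t :
  hmul n (sprod_seq a s) (sprod_seq b t) =
  if (size s == a) && (size t == b) then sprod_seq n (s ++ t) else 0.
Proof.
have [sa|ne] := boolP (size s == a); last by rewrite sprod_seq_neq // hmul0l.
have [tb|ne] := boolP (size t == b); last first.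
  by rewrite (sprod_seq_neq ne) linear0.
rewrite -[s]/(val (Tuple sa)) -[t]/(val (Tuple tb)) !sprod_seq_tuple.
by rewrite hmul_sprod.
Qed.

(* The product of all symmetric powers, with its convolution product: power   *)
(* series with coefficients in symmetric powers, constant terms allowed.      *)
Definition symser : Type := dprod (sympow V).

HB.instance Definition _ := GRing.Lmodule.on symser.

Implicit Types x y z : symser.

Definition symser_one : symser := fun n => sprod_seq n [::].

Definition symser_mul x y : symser :=
  fun n => \sum_(i < n.+1) sym_cast n (sym_mul (x i) (y (n - i)%N)).

Lemma symser_mulE N x y n : (n < N)%N ->
  symser_mul x y n = \sum_(i < N) \sum_(j < N) hmul n (x i) (y j).
Proof.
move=> nN; rewrite /symser_mul (big_ord_widen_cond _ xpredT
  (fun i => sym_cast n (sym_mul (x i) (y (n - i)%N))) nN) /=.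
rewrite [RHS](bigID (fun i : 'I_N => (i < n.+1)%N)) /= [X in _ + X]big1 ?addr0.
  apply: eq_bigr => i iN; have jN : (n - i < N)%N by rewrite (leq_ltn_trans (leq_subr _ _)).
  rewrite (bigD1 (Ordinal jN)) //= big1 ?addr0 // => j /eqP jn.
  apply: hmul_neq => e; apply: jn; apply: val_inj => /=.
  by rewrite -e addKn.
move=> i; rewrite -leqNgt => ni; apply: big1 => j _; apply: hmul_neq => e.
by move: ni; rewrite -e ltnNge leq_addr.
Qed.

Lemma big_ord_if (N k : nat) (U : nmodType) (c : U) :
  \sum_(i < N) (if k == i :> nat then c else 0) = if (k < N)%N then c else 0.
Proof.
case: ltnP => kN; last first.
  by apply: big1 => i _; case: eqP => // e; rewrite e leqNgt ltn_ord in kN.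
rewrite (bigD1 (Ordinal kN)) //= eqxx big1 ?addr0 // => i /eqP ne.
by case: eqP => // e; case: ne; apply: val_inj.
Qed.

Lemma hmulA_sum n a b c (x : sympow V a) (y : sympow V b) (z : sympow V c) :
  \sum_(i < n.+1) hmul n (hmul i x y) z = \sum_(i < n.+1) hmul n x (hmul i y z).
Proof.
elim/sympow_ind: x => [u||x1 x2 e1 e2|d x e].
- elim/sympow_ind: y => [v||y1 y2 e1 e2|d y e].
  + elim/sympow_ind: z => [w||z1 z2 e1 e2|d z e].
    * transitivity (sprod_seq n (u ++ v ++ w)).
        under eq_bigr => i _ do rewrite hmul_sprod -(sprod_seq_tuple w)
          hmul_sprod_seq size_tuple eqxx andbT -catA.
        rewrite big_ord_if; case: ltnP => // le.
        rewrite sprod_seq_neq // catA size_cat.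
        by apply/eqP => e; move: le; rewrite -e ltnNge leq_addr.
      under eq_bigr => i _ do rewrite hmul_sprod -(sprod_seq_tuple u)
        hmul_sprod_seq size_tuple eqxx.
      rewrite big_ord_if; case: ltnP => // le.
      rewrite sprod_seq_neq // size_cat.
      by apply/eqP => e; move: le; rewrite -e ltnNge leq_addl.
    * by rewrite !big1 // => i _; rewrite !linear0.
    * under eq_bigr do rewrite linearD; rewrite big_split /= e1 e2 -big_split.
      by apply: eq_bigr => i _; rewrite /= !linearD.
    * under eq_bigr do rewrite linearZ; rewrite -scaler_sumr /= e scaler_sumr.
      by apply: eq_bigr => i _; rewrite /= !linearZ.
  + by rewrite !big1 // => i _; rewrite ?linear0 !hmul0l ?linear0.
  + under eq_bigr do rewrite linearD hmulDl; rewrite big_split /= e1 e2 -big_split.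
    by apply: eq_bigr => i _; rewrite /= hmulDl linearD.
  + under eq_bigr do rewrite linearZ hmulZl; rewrite -scaler_sumr /= e scaler_sumr.
    by apply: eq_bigr => i _; rewrite /= hmulZl linearZ.
- by rewrite !big1 // => i _; rewrite !hmul0l.
- under eq_bigr do rewrite !hmulDl; rewrite big_split /= e1 e2 -big_split.
  by apply: eq_bigr => i _; rewrite /= hmulDl.
- under eq_bigr do rewrite !hmulZl; rewrite -scaler_sumr /= e scaler_sumr.
  by apply: eq_bigr => i _; rewrite /= hmulZl.
Qed.

Lemma hmulC n a b (x : sympow V a) (y : sympow V b) : hmul n x y = hmul n y x.
Proof.
elim/sympow_ind: x => [u||x1 x2 e1 e2|d x e].
- elim/sympow_ind: y => [v||y1 y2 e1 e2|d y e].
  + by rewrite !hmul_sprod; apply: sprod_seq_perm; rewrite perm_catC.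
  + by rewrite hmul0l linear0.
  + by rewrite hmulDl linearD /= e1 e2.
  + by rewrite hmulZl linearZ /= e.
- by rewrite hmul0l linear0.
- by rewrite hmulDl linearD /= e1 e2.
- by rewrite hmulZl linearZ /= e.
Qed.

Lemma symser_mulA : associative symser_mul.
Proof.
move=> x y z; apply: dprodP => n; rewrite !(symser_mulE _ _ (ltnSn n)).
transitivity (\sum_(i < n.+1) \sum_(a < n.+1) \sum_(b < n.+1) \sum_(j < n.+1)
                 hmul n (x i) (hmul j (y a) (z b))).
  apply: eq_bigr => i _.
  rewrite [RHS](eq_bigr (fun a : 'I_n.+1 => \sum_(j < n.+1) \sum_(b < n.+1)
            hmul n (x i) (hmul j (y a) (z b)))); last first.
    by move=> a _; apply: exchange_big.
  rewrite [RHS]exchange_big; apply: eq_bigr => j _ /=.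
  rewrite (symser_mulE _ _ (ltn_ord j)) linear_sum; apply: eq_bigr => a _.
  by rewrite linear_sum.
under eq_bigr => i _ do under eq_bigr => a _ do under eq_bigr => b _ do
  rewrite -hmulA_sum.
under eq_bigr => i _ do under eq_bigr => a _ do rewrite exchange_big /=.
under eq_bigr => i _ do rewrite exchange_big /=.
rewrite exchange_big /=; apply: eq_bigr => j _.
under eq_bigr => i _ do rewrite exchange_big /=.
rewrite exchange_big /=; apply: eq_bigr => b _.
rewrite (symser_mulE _ _ (ltn_ord j)) hmul_suml; apply: eq_bigr => i _.
by rewrite hmul_suml.
Qed.

Lemma symser_mulC : commutative symser_mul.
Proof.
move=> x y; apply: dprodP => n; rewrite !(symser_mulE _ _ (ltnSn n)).
rewrite exchange_big; apply: eq_bigr => i _; apply: eq_bigr => j _.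
exact: hmulC.
Qed.

Lemma hmul1l n a (x : sympow V a) :
  hmul n (sprod_seq 0 [::]) x = sym_cast n x.
Proof.
suff : hmul n (sprod_seq 0 [::]) =1 linear_map (@sym_cast_linear a n).
  by move=> ->; rewrite linear_mapE.
apply: sympow_linear_eq => v /=; rewrite linear_mapE sym_cast_sprod.
by rewrite -(sprod_seq_tuple v) hmul_sprod_seq size_tuple eqxx.
Qed.

Lemma symser_mul1 : left_id symser_one symser_mul.
Proof.
move=> x; apply: dprodP => n; rewrite /symser_mul big_ord_recl big1 ?addr0.
  by rewrite [LHS]hmul1l subn0 sym_cast_id.
by move=> i _; rewrite /symser_one sprod_seq_neq //; apply: hmul0l.
Qed.

Lemma symser_mulDl : left_distributive symser_mul +%R.
Proof.
move=> x y z; apply: dprodP => n; rewrite dprodDE /symser_mul -big_split.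
by apply: eq_bigr => i _; apply: hmulDl.
Qed.

HB.instance Definition _ := GRing.Zmodule_isComPzRing.Build symser
  symser_mulA symser_mulC symser_mul1 symser_mulDl.

Lemma symser_mulZl a x y : (a *: x) * y = a *: (x * y).
Proof.
apply: dprodP => n; rewrite -[LHS]/(symser_mul (a *: x) y n).
rewrite -[RHS]/(a *: symser_mul x y n) /symser_mul scaler_sumr.
by apply: eq_bigr => i _; apply: hmulZl.
Qed.

(* The series concentrated in degree [n] with value [x]. *)
Definition homog n (x : sympow V n) : symser := fun m => sym_cast m x.
End SymmetricProduct.

Section LinearCategory.
Variable F : fieldType.
Implicit Types U V W X : lmodType F.

Definition lin_id V : {linear V -> V} := idfun.

Definition lin_comp U V W (g : {linear V -> W}) (f : {linear U -> V}) :
  {linear U -> W} := g \o f.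

(* The biproduct of [V] and [W] is the library's module structure on [V * W]. *)
Lemma bi_proj0_linear V W : linear (fun p : (V * W)%type => p.1). Proof. by []. Qed.
Lemma bi_proj1_linear V W : linear (fun p : (V * W)%type => p.2). Proof. by []. Qed.

Definition bi_proj0 V W : {linear (V * W)%type -> V} := linear_map (@bi_proj0_linear V W).
Definition bi_proj1 V W : {linear (V * W)%type -> W} := linear_map (@bi_proj1_linear V W).

Lemma bi_inj0_linear V W : linear (fun v : V => (v, 0 : W)).
Proof. by move=> a x y; congr pair; rewrite /= scaler0 addr0. Qed.

Lemma bi_inj1_linear V W : linear (fun w : W => (0 : V, w)).
Proof. by move=> a x y; congr pair; rewrite /= scaler0 addr0. Qed.

Definition bi_inj0 V W : {linear V -> (V * W)%type} := linear_map (@bi_inj0_linear V W).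
Definition bi_inj1 V W : {linear W -> (V * W)%type} := linear_map (@bi_inj1_linear V W).

Lemma bi_pair_linear U V W (f : {linear U -> V}) (g : {linear U -> W}) :
  linear (fun u => (f u, g u)).
Proof. by move=> a x y; rewrite !linearP. Qed.

Definition bi_pair U V W (f : {linear U -> V}) (g : {linear U -> W}) :
  {linear U -> (V * W)%type} := linear_map (bi_pair_linear f g).

Lemma bi_copair_linear U V W (f : {linear U -> W}) (g : {linear V -> W}) :
  linear (fun p : (U * V)%type => f p.1 + g p.2).
Proof. by move=> a x y; rewrite /= !linearP scalerDr addrACA. Qed.

Definition bi_copair U V W (f : {linear U -> W}) (g : {linear V -> W}) :
  {linear (U * V)%type -> W} := linear_map (bi_copair_linear f g).

Definition bi_map U V W X (f : {linear U -> W}) (g : {linear V -> X}) :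
  {linear (U * V)%type -> (W * X)%type} :=
  bi_pair (lin_comp f (bi_proj0 U V)) (lin_comp g (bi_proj1 U V)).

Definition bi_diag V : {linear V -> (V * V)%type} := bi_pair (lin_id V) (lin_id V).

(* c_V ((a, b), (c, d)) = ((a, c), (b, d)) *)
Definition bi_interchange V : 
  {linear ((V * V) * (V * V))%type -> ((V * V) * (V * V))%type} :=
  bi_pair (bi_map (bi_proj0 V V) (bi_proj0 V V))
          (bi_map (bi_proj1 V V) (bi_proj1 V V)).
End LinearCategory.

Arguments lin_id {F} V.
Arguments bi_proj0 {F} V W.
Arguments bi_proj1 {F} V W.
Arguments bi_inj0 {F} V W.
Arguments bi_inj1 {F} V W.
Arguments bi_diag {F} V.
Arguments bi_interchange {F} V.

Record monad (F : fieldType) := Monad {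
  mon_obj : lmodType F -> lmodType F;
  mon_map : forall V W : lmodType F,
    {linear V -> W} -> {linear mon_obj V -> mon_obj W};
  mon_mult : forall V : lmodType F, {linear mon_obj (mon_obj V) -> mon_obj V};
  mon_unit : forall V : lmodType F, {linear V -> mon_obj V};
  mon_map_id : forall (V : lmodType F) x, mon_map (lin_id V) x = x;
  mon_map_comp : forall (U V W : lmodType F)
    (g : {linear V -> W}) (f : {linear U -> V}) x,
    mon_map (lin_comp g f) x = mon_map g (mon_map f x);
  mon_unit_natural : forall (V W : lmodType F) (f : {linear V -> W}) x,
    mon_map f (mon_unit V x) = mon_unit W (f x);
  mon_mult_natural : forall (V W : lmodType F) (f : {linear V -> W}) x,
    mon_map f (mon_mult V x) = mon_mult W (mon_map (mon_map f) x);
  mon_mult_unit : forall (V : lmodType F) x,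
    mon_mult V (mon_unit (mon_obj V) x) = x;
  mon_mult_map_unit : forall (V : lmodType F) x,
    mon_mult V (mon_map (mon_unit V) x) = x;
  mon_mult_assoc : forall (V : lmodType F) x,
    mon_mult V (mon_mult (mon_obj V) x) = mon_mult V (mon_map (mon_mult V) x)
}.

Coercion mon_obj : monad >-> Funclass.

Record differential_combinator_transformation (F : fieldType) (S : monad F)
    (d : forall V : lmodType F, {linear S V -> S (V * V)%type}) : Prop := {
  dc_natural : forall (V W : lmodType F) (f : {linear V -> W}) x,
    mon_map S (bi_map f f) (d V x) = d W (mon_map S f x);
  dc1 : forall (V : lmodType F) x, mon_map S (bi_proj0 V V) (d V x) = 0;
  dc2 : forall (V : lmodType F) x,
    mon_map S (bi_map (lin_id V) (bi_diag V)) (d V x) =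
    mon_map S (bi_map (lin_id V) (bi_inj0 V V)) (d V x) +
    mon_map S (bi_map (lin_id V) (bi_inj1 V V)) (d V x);
  dc3 : forall (V : lmodType F) x,
    d V (mon_unit S V x) = mon_unit S (V * V)%type (bi_inj1 V V x);
  dc4 : forall (V : lmodType F) x,
    d V (mon_mult S V x) =
    mon_mult S (V * V)%type
      (mon_map S (bi_copair (mon_map S (bi_inj0 V V)) (d V)) (d (S V) x));
  dc5 : forall (V : lmodType F) x,
    mon_map S (bi_map (bi_proj0 V V) (bi_proj1 V V))
      (d (V * V)%type (d V x)) = d V x;
  dc6 : forall (V : lmodType F) x,
    mon_map S (bi_interchange V) (d (V * V)%type (d V x)) =
    d (V * V)%type (d V x)
}.

Section SymMap.
Variables (F : fieldType) (V W : lmodType F) (f : {linear V -> W}) (n : nat).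

Lemma map_tuple_upd (v : n.-tuple V) j x :
  map_tuple f (tuple_upd v j x) = tuple_upd (map_tuple f v) j (f x).
Proof.
by apply: eq_from_tnth => i; rewrite !(tnth_map, tnth_mktuple); case: eqP.
Qed.

Lemma sprod_map_multilinear :
  multilinear (fun v : n.-tuple V => sprod (map_tuple f v)).
Proof.
by move=> v j a x y; rewrite !map_tuple_upd linearP sprod_multilinear.
Qed.

Lemma sprod_map_symmetric :
  symmetric_fun (fun v : n.-tuple V => sprod (map_tuple f v)).
Proof.
by move=> v s; apply/sprod_perm_eq/perm_map/perm_eq_tuple_perm.
Qed.

Definition sym_map : {linear sympow V n -> sympow W n} :=
  sym_lift sprod_map_multilinear sprod_map_symmetric.

Lemma sym_mapE v : sym_map (sprod v) = sprod (map_tuple f v).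
Proof. exact: sym_liftE. Qed.

Lemma sym_map_sprod_seq s : sym_map (sprod_seq n s) = sprod_seq n (map f s).
Proof.
have [e|ne] := boolP (size s == n); last first.
  by rewrite !sprod_seq_neq ?linear0 ?size_map.
by rewrite -[s]/(val (Tuple e)) sprod_seq_tuple sym_mapE -sprod_seq_tuple.
Qed.
End SymMap.

Lemma sym_map_hmul (F : fieldType) (V W : lmodType F) (f : {linear V -> W})
    n a b (x : sympow V a) (y : sympow V b) :
  sym_map f n (hmul n x y) = hmul n (sym_map f a x) (sym_map f b y).
Proof.
elim/sympow_ind: x => [u||x1 x2 e1 e2|d x e].
- elim/sympow_ind: y => [v||y1 y2 e1 e2|d y e].
  + rewrite hmul_sprod sym_map_sprod_seq !sym_mapE hmul_sprod.
    by rewrite map_cat.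
  + by rewrite !linear0.
  + by rewrite !linearD /= e1 e2.
  + by rewrite !linearZ /= e.
- by rewrite hmul0l !linear0 hmul0l.
- by rewrite hmulDl !linearD hmulDl e1 e2.
- by rewrite hmulZl !linearZ /= hmulZl e.
Qed.

Section PowerSeries.
Variable F : fieldType.
Implicit Types U V W : lmodType F.

(* Degrees are shifted: [t n] is the term of degree [n.+1] of the series [t]. *)
Definition pser V : lmodType F := dprod (fun n => sympow V n.+1).

Lemma pser_map_linear V W (f : {linear V -> W}) :
  linear (fun (t : pser V) => (fun n => sym_map f n.+1 (t n)) : pser W).
Proof. by move=> a x y; apply: dprodP => n; apply: linearP. Qed.

Definition pser_map V W (f : {linear V -> W}) : {linear pser V -> pser W} :=
  linear_map (pser_map_linear f).

Definition pser_unit_fun V (v : V) : pser V := fun n =>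
  match n return sympow V n.+1 with 0%N => sprod [tuple v] | _.+1 => 0 end.

Lemma pser_unit_linear V : linear (@pser_unit_fun V).
Proof.
move=> a x y; apply: dprodP => -[|n].
  have E (z : V) : [tuple z] = tuple_upd [tuple x] ord0 z.
    by apply: eq_from_tnth => i; rewrite tnth_mktuple (ord1 i).
  by rewrite /pser_unit_fun E sprod_multilinear -!E.
by rewrite dprodDE dprodZE /= scaler0 addr0.
Qed.

Definition pser_unit V : {linear V -> pser V} := linear_map (@pser_unit_linear V).

(* The sum of the products s_1(n_1) * ... * s_k(n_k) over the ordered tuples   *)
(* of positive integers [n_j = (c j).+1] with sum [n]. It is the sum over all  *)
(* tuples, not each summand, that is symmetric in the s_j and descends to the  *)
(* coinvariants. The [*]-product of homogeneous elements of degrees n_1, ...,  *)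
(* n_k is formed in [symser V] and its term of degree [n] extracted, which     *)
(* avoids transports between degrees.                                          *)
Definition mult_term V k n (s : k.-tuple (pser V)) : sympow V n :=
  \sum_(c : {ffun 'I_k -> 'I_n} | (\sum_(j < k) (c j).+1)%N == n)
    (\prod_(j < k) homog (tnth s j (c j))) n.

Definition pser_incl V (t : pser V) : symser V := fun n =>
  match n return sympow V n with 0%N => 0 | m.+1 => t m end.

Lemma pser_incl_linear V : linear (@pser_incl V).
Proof.
by move=> a x y; apply: dprodP => -[|n] //; rewrite dprodDE dprodZE scaler0 addr0.
Qed.

Lemma symser_mul_coefE V (x y : symser V) N n : (n < N)%N ->
  (x * y) n = \sum_(i < N) \sum_(j < N) hmul n (x i) (y j).
Proof. exact: symser_mulE. Qed.

Definition symser_eq_upto V n (x y : symser V) := forall m, (m <= n)%N -> x m = y m.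

Lemma symser_eq_upto_prod V n k (x y : 'I_k -> symser V) :
  (forall j, symser_eq_upto n (x j) (y j)) ->
  symser_eq_upto n (\prod_(j < k) x j) (\prod_(j < k) y j).
Proof.
move=> xy; apply: (big_ind2 (symser_eq_upto n)) => // x1 y1 x2 y2 e1 e2 m mn.
rewrite !(symser_mul_coefE _ _ (ltnSn m)).
by apply: eq_bigr => i _; apply: eq_bigr => j _; rewrite e1 ?e2 //;
  apply: leq_trans mn; rewrite -ltnS.
Qed.

Lemma homog_prod_neq V k (d : 'I_k -> nat) (x : forall j, sympow V (d j)) n :
  (\sum_(j < k) d j)%N != n -> (\prod_(j < k) homog (x j)) n = 0.
Proof.
move: n; apply: (big_ind2 (fun d (y : symser V) =>
  forall n, d != n -> y n = 0)) => [n|d1 y1 d2 y2 e1 e2 n ne|j _ n /eqP].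
- by move=> ?; apply: sprod_seq_neq.
- rewrite (symser_mul_coefE _ _ (ltnSn n)); apply: big1 => i _; apply: big1 => j _.
  have [ei|/e1 ->] := eqVneq d1 i; last by rewrite hmul0l.
  have [ej|/e2 ->] := eqVneq d2 j; last by rewrite linear0.
  by apply: hmul_neq; rewrite -ei -ej; apply/eqP.
- exact: sym_cast_neq.
Qed.

Lemma mult_termE V k n (s : k.-tuple (pser V)) :
  mult_term n s = (\prod_(j < k) pser_incl (tnth s j)) n.
Proof.
pose T j : symser V := \sum_(m < n) homog (tnth s j m).
transitivity ((\prod_(j < k) T j) n); last first.
  apply: (@symser_eq_upto_prod V n k) => // j m mn; rewrite /T dprod_sumE /=.
  case: m mn => [|m] mn /=.
    by apply: big1 => i _; apply: sym_cast_neq.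
  rewrite (bigD1 (Ordinal mn)) //= big1 => [|i /eqP ne].
    by rewrite addr0; apply: sym_cast_id.
  by apply: sym_cast_neq => -[e]; apply: ne; apply: val_inj.
rewrite /T bigA_distr_bigA dprod_sumE /mult_term [RHS](bigID (fun c : {ffun 'I_k -> 'I_n} =>
  (\sum_(j < k) (c j).+1)%N == n)) /= [X in _ = _ + X]big1 ?addr0 // => c ne.
exact: homog_prod_neq.
Qed.

Lemma mult_term_multilinear V k n : multilinear (@mult_term V k n).
Proof.
move=> s j a x y; rewrite !mult_termE.
pose R := \prod_(i < k | i != j) pser_incl (tnth s i).
have E z : \prod_(i < k) pser_incl (tnth (tuple_upd s j z) i) = pser_incl z * R.
  rewrite (bigD1 j) //= tnth_mktuple eqxx; congr (_ * _).
  by apply: eq_bigr => i /negPf ne; rewrite tnth_mktuple ne.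
rewrite !E; have -> : pser_incl (a *: x + y) = a *: pser_incl x + pser_incl y.
  exact: pser_incl_linear.
by rewrite mulrDl symser_mulZl.
Qed.

Lemma mult_term_symmetric V k n : symmetric_fun (@mult_term V k n).
Proof.
move=> s p; rewrite !mult_termE [in RHS](reindex_inj (@perm_inj _ p)) /=.
by under eq_bigr do rewrite tnth_mktuple.
Qed.

Definition mult_lift V k n : {linear sympow (pser V) k -> sympow V n} :=
  sym_lift (@mult_term_multilinear V k n) (@mult_term_symmetric V k n).

Lemma mult_liftE V k n s :
  mult_lift V k n (sprod s) = mult_term n s.
Proof. exact: sym_liftE. Qed.

Lemma pser_mult_linear V :
  linear (fun (s : pser (pser V)) =>
    (fun n => \sum_(k < n.+1) mult_lift V k.+1 n.+1 (s k)) : pser V).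
Proof.
move=> a x y; apply: dprodP => n; rewrite dprodDE dprodZE scaler_sumr -big_split.
by apply: eq_bigr => k _; apply: linearP.
Qed.

Definition pser_mult V : {linear pser (pser V) -> pser V} :=
  linear_map (@pser_mult_linear V).

Lemma pser_multE V (s : pser (pser V)) n :
  pser_mult V s n = \sum_(k < n.+1) mult_lift V k.+1 n.+1 (s k).
Proof. by []. Qed.


Lemma pser_mult_sum V (s : pser (pser V)) n (m : nat -> nat)
    (v : forall k, 'I_(m k) -> k.+1.-tuple (pser V)) :
  (forall k, s k = \sum_(i < m k) sprod (v k i)) ->
  pser_mult V s n = \sum_(k < n.+1) \sum_(i < m k) mult_term n.+1 (v k i).
Proof.
move=> sE; rewrite pser_multE; apply: eq_bigr => k _; rewrite sE linear_sum.
by apply: eq_bigr => i _; rewrite /= mult_liftE.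
Qed.

(* Multiplicative extension of [pser_mult] to series with constant terms. *)
Definition symser_mult V (a : symser (pser V)) : symser V :=
  fun n => \sum_(k < n.+1) mult_lift V k n (a k).

Lemma mult_lift_gt V k n x : (n < k)%N -> mult_lift V k n x = 0.
Proof.
move=> nk; elim/sympow_ind: x => [s||x y ex ey|a x ex].
- rewrite mult_liftE /mult_term big1 // => c /eqP e.
  move: nk; rewrite ltnNge -[X in (_ <= X)%N]e -[X in (X <= _)%N]card_ord.
  by rewrite -sum1_card leq_sum.
- exact: linear0.
- by rewrite linearD ex ey addr0.
- by rewrite linearZ ex /= scaler0.
Qed.

Lemma symser_mult_coefE V (a : symser (pser V)) N n : (n < N)%N ->
  symser_mult a n = \sum_(k < N) mult_lift V k n (a k).
Proof.
move=> nN; rewrite /symser_mult (big_ord_widen_cond _ xpredT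
  (fun k => mult_lift V k n (a k)) nN) /=.
rewrite [RHS](bigID (fun i : 'I_N => (i < n.+1)%N)) /= [X in _ + X]big1 ?addr0 //.
by move=> i; rewrite -leqNgt => ni; apply: mult_lift_gt.
Qed.

Lemma mult_lift_hmul V i j n (x : sympow (pser V) i) (y : sympow (pser V) j) :
  \sum_(k < n.+1) mult_lift V k n (hmul k x y) =
  \sum_(p < n.+1) \sum_(q < n.+1)
    hmul n (mult_lift V i p x) (mult_lift V j q y).
Proof.
elim/sympow_ind: x => [u||x1 x2 e1 e2|d x e].
- elim/sympow_ind: y => [v||y1 y2 e1 e2|d y e].
  + pose uv := cat_tuple u v.
    transitivity (mult_lift V (i + j) n (sprod uv)).
      have [le|gt] := leqP (i + j) n.
        have lt : (i + j < n.+1)%N by [].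
        rewrite (bigD1 (Ordinal lt)) //= hmul_sprod (sprod_seq_tuple uv).
        rewrite big1 ?addr0 // => k /eqP ne; rewrite hmul_neq ?linear0 // => e.
        by apply: ne; apply: val_inj.
      rewrite mult_lift_gt // big1 // => k _; rewrite hmul_neq ?linear0 // => e.
      by have := ltn_ord k; rewrite -e ltnS leqNgt gt.
    rewrite mult_liftE mult_termE.
    have -> : \prod_(k < i + j) pser_incl (tnth uv k) =
        (\prod_(k < i) pser_incl (tnth u k)) * \prod_(k < j) pser_incl (tnth v k).
      rewrite big_split_ord; congr (_ * _); apply: eq_bigr => k _.
        by rewrite tnth_lshift.
      by rewrite tnth_rshift.
    rewrite (symser_mul_coefE _ _ (ltnSn n)).
    by apply: eq_bigr => p _; apply: eq_bigr => q _; rewrite !mult_liftE !mult_termE.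
  + rewrite !big1 // => k _; last by rewrite !linear0.
    by rewrite big1 // => q _; rewrite !linear0.
  + under eq_bigr do rewrite !linearD.
    rewrite big_split /= e1 e2 -big_split; apply: eq_bigr => p _ /=.
    by rewrite -big_split; apply: eq_bigr => q _ /=; rewrite !linearD.
  + under eq_bigr do rewrite !linearZ.
    rewrite -scaler_sumr /= e scaler_sumr; apply: eq_bigr => p _ /=.
    by rewrite scaler_sumr; apply: eq_bigr => q _ /=; rewrite !linearZ.
- rewrite !big1 // => k _; last by rewrite hmul0l linear0.
  by rewrite big1 // => q _; rewrite linear0 hmul0l.
- under eq_bigr do rewrite hmulDl !linearD.
  rewrite big_split /= e1 e2 -big_split; apply: eq_bigr => p _ /=.
  by rewrite -big_split; apply: eq_bigr => q _ /=; rewrite linearD hmulDl.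
- under eq_bigr do rewrite hmulZl !linearZ.
  rewrite -scaler_sumr /= e scaler_sumr; apply: eq_bigr => p _ /=.
  by rewrite scaler_sumr; apply: eq_bigr => q _ /=; rewrite linearZ hmulZl.
Qed.

Lemma symser_multM V (a b : symser (pser V)) :
  symser_mult (a * b) = symser_mult a * symser_mult b.
Proof.
apply: dprodP => n; rewrite (symser_mul_coefE _ _ (ltnSn n)).
transitivity (\sum_(i < n.+1) \sum_(j < n.+1) \sum_(k < n.+1)
    mult_lift V k n (hmul k (a i) (b j))).
  rewrite /symser_mult.
  under eq_bigr => k _ do
    rewrite (symser_mul_coefE _ _ (ltn_ord k)) linear_sum /=.
  rewrite exchange_big; apply: eq_bigr => i _ /=.
  under eq_bigr => k _ do rewrite linear_sum /=.
  by rewrite exchange_big.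
under eq_bigr => i _ do under eq_bigr => j _ do rewrite mult_lift_hmul.
under eq_bigr => i _ do rewrite exchange_big /=.
rewrite exchange_big /=; apply: eq_bigr => p _.
under eq_bigr => i _ do rewrite exchange_big /=.
rewrite exchange_big /=; apply: eq_bigr => q _.
rewrite (symser_mult_coefE a (ltn_ord p)) (symser_mult_coefE b (ltn_ord q)).
rewrite hmul_suml; apply: eq_bigr => i _.
by rewrite linear_sum.
Qed.

Lemma symser_mult1 V : symser_mult 1 = 1 :> symser V.
Proof.
apply: dprodP => n; rewrite (symser_mult_coefE _ (ltnSn n)) big_ord_recl big1.
  rewrite -[(1 : symser (pser V)) _]/(sprod_seq 0 (nil_tuple (pser V))).
  by rewrite sprod_seq_tuple mult_liftE mult_termE big_ord0 addr0.
move=> i _; rewrite -[(1 : symser (pser V)) _]/(sprod_seq _ [::]).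
by rewrite sprod_seq_neq ?linear0.
Qed.

Lemma symser_mult_prod V k (a : 'I_k -> symser (pser V)) :
  symser_mult (\prod_(j < k) a j) = \prod_(j < k) symser_mult (a j).
Proof. by apply: big_morph; [apply: symser_multM | apply: symser_mult1]. Qed.

Lemma symser_mult_incl V (s : pser (pser V)) :
  symser_mult (pser_incl s) = pser_incl (pser_mult V s).
Proof.
apply: dprodP => n; rewrite /symser_mult big_ord_recl linear0 add0r.
by case: n => [|n]; rewrite ?big_ord0.
Qed.

Definition symser_map V W (f : {linear V -> W}) (x : symser V) : symser W :=
  fun n => sym_map f n (x n).

Lemma symser_map_prod V W (f : {linear V -> W}) k (x : 'I_k -> symser V) :
  symser_map f (\prod_(j < k) x j) = \prod_(j < k) symser_map f (x j).
Proof.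
apply: big_morph => [a b|]; apply: dprodP => n; last exact: sym_map_sprod_seq.
rewrite /symser_map !(symser_mul_coefE _ _ (ltnSn n)) linear_sum.
apply: eq_bigr => i _ /=; rewrite linear_sum; apply: eq_bigr => j _.
exact: sym_map_hmul.
Qed.

Lemma symser_map_incl V W (f : {linear V -> W}) t :
  symser_map f (pser_incl t) = pser_incl (pser_map f t).
Proof. by apply: dprodP => -[|n] //; apply: linear0. Qed.

Lemma sym_map_mult_lift V W (f : {linear V -> W}) k n x :
  sym_map f n (mult_lift V k n x) =
  mult_lift W k n (sym_map (pser_map f) k x).
Proof.
elim/sympow_ind: x => [s||x y ex ey|a x ex].
- rewrite mult_liftE (sym_mapE (pser_map f)) mult_liftE !mult_termE.
  rewrite -[LHS]/(symser_map f _ n) symser_map_prod.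
  by under eq_bigr do rewrite symser_map_incl -tnth_map.
- by rewrite !linear0.
- by rewrite !linearD /= ex ey.
- by rewrite !linearZ /= ex.
Qed.

Lemma homog_prod V k (v : k.-tuple V) n :
  (\prod_(j < k) homog (sprod [tuple tnth v j])) n = sprod_seq n v.
Proof.
rewrite -(big_tuple _ _ v xpredT (fun x => homog (sprod [tuple x]))) /=.
elim: (val v) n => [|x s IHs] n; first by rewrite big_nil.
rewrite big_cons (symser_mul_coefE _ _ (ltnSn n)).
transitivity (\sum_(i < n.+1) if 1%N == i then
    \sum_(j < n.+1) (if size s == j then sprod_seq n (x :: s) else 0) else 0).
  apply: eq_bigr => i _; transitivity (\sum_(j < n.+1)
      if 1%N == i then if size s == j then sprod_seq n (x :: s) else 0 else 0).
    apply: eq_bigr => j _; rewrite IHs /homog sym_cast_sprod hmul_sprod_seq /=.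
    by case: (1%N == i).
  by case: (1%N == i); rewrite // big1.
rewrite !big_ord_if.
have [<-|ne] := eqVneq (size (x :: s)) n; first by rewrite /= !ltnS leqnSn.
by rewrite sprod_seq_neq //; do 2?case: ifP.
Qed.

Lemma mult_lift_map_unit V k n (x : sympow V k) :
  mult_lift V k n (sym_map (pser_unit V) k x) = sym_cast n x.
Proof.
suff : lin_comp (mult_lift V k n) (sym_map (pser_unit V) k) =1
       linear_map (@sym_cast_linear _ V k n) by apply.
apply: sympow_linear_eq => v; rewrite linear_mapE sym_cast_sprod -homog_prod /=.
rewrite sym_mapE mult_liftE mult_termE.
suff E j : pser_incl (tnth (map_tuple (pser_unit V) v) j) =
           homog (sprod [tuple tnth v j]).
  by rewrite (eq_bigr _ (fun j _ => E j)).
rewrite tnth_map; apply: dprodP => -[|[|m]]; rewrite /homog.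
- by rewrite sym_cast_neq.
- by rewrite sym_cast_id.
- by rewrite sym_cast_neq.
Qed.

Lemma pser_map_id V x : pser_map (lin_id V) x = x.
Proof.
apply: dprodP => n.
suff : sym_map (lin_id V) n.+1 =1 lin_id (sympow V n.+1) by apply.
apply: sympow_linear_eq => v; rewrite sym_mapE; congr sprod.
by apply: eq_from_tnth => i; rewrite tnth_map.
Qed.

Lemma pser_map_comp U V W (g : {linear V -> W}) (f : {linear U -> V}) x :
  pser_map (lin_comp g f) x = pser_map g (pser_map f x).
Proof.
apply: dprodP => n.
suff : sym_map (lin_comp g f) n.+1 =1 lin_comp (sym_map g n.+1) (sym_map f n.+1).
  by apply.
apply: sympow_linear_eq => v /=; rewrite !sym_mapE; congr sprod.
by apply: eq_from_tnth => i; rewrite !tnth_map.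
Qed.

Lemma pser_unit_natural V W (f : {linear V -> W}) x :
  pser_map f (pser_unit V x) = pser_unit W (f x).
Proof.
apply: dprodP => -[|n]; last exact: linear0.
rewrite [LHS]sym_mapE; congr sprod.
by apply: eq_from_tnth => i; rewrite tnth_map (ord1 i).
Qed.

Lemma pser_mult_natural V W (f : {linear V -> W}) x :
  pser_map f (pser_mult V x) = pser_mult W (pser_map (pser_map f) x).
Proof.
apply: dprodP => n; rewrite [LHS]linear_sum; apply: eq_bigr => k _.
exact: sym_map_mult_lift.
Qed.

Lemma pser_mult_unit V x : pser_mult V (pser_unit (pser V) x) = x.
Proof.
apply: dprodP => n; rewrite pser_multE big_ord_recl big1 ?addr0.
  by rewrite mult_liftE mult_termE big_ord_recl big_ord0 mulr1.
by move=> i _; apply: linear0.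
Qed.

Lemma pser_mult_map_unit V x : pser_mult V (pser_map (pser_unit V) x) = x.
Proof.
apply: dprodP => n; rewrite pser_multE.
under eq_bigr => k _ do rewrite [mult_lift _ _ _ _]mult_lift_map_unit.
rewrite big_ord_recr big1 /= ?add0r ?sym_cast_id // => k _.
by apply: sym_cast_neq => -[e]; have := ltn_ord k; rewrite e ltnn.
Qed.

Lemma pser_mult_assoc V x :
  pser_mult V (pser_mult (pser V) x) = pser_mult V (pser_map (pser_mult V) x).
Proof.
suff E k n (y : sympow (pser (pser V)) k) :
    \sum_(l < n.+1) mult_lift V l n (mult_lift (pser V) k l y) =
    mult_lift V k n (sym_map (pser_mult V) k y).
  apply: (can_inj (g := fun (z : symser V) n => z n.+1) (f := @pser_incl V)) => //.
  rewrite -!symser_mult_incl; apply: dprodP => n.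
  rewrite [LHS](symser_mult_coefE _ (ltnSn n)).
  rewrite [RHS](symser_mult_coefE _ (ltnSn n)).
  under eq_bigr => l _ do
    rewrite (symser_mult_coefE _ (ltn_ord l)) linear_sum /=.
  rewrite exchange_big; apply: eq_bigr => k _ /=; rewrite E.
  by case: (nat_of_ord k) => [|k']; rewrite //= !linear0.
elim/sympow_ind: y => [s||y z ey ez|a y ey].
- under eq_bigr do rewrite mult_liftE mult_termE.
  rewrite -[LHS]/(symser_mult _ n) symser_mult_prod sym_mapE mult_liftE mult_termE.
  by under eq_bigr do rewrite symser_mult_incl -tnth_map.
- by rewrite !linear0 big1 // => l _; rewrite !linear0.
- under eq_bigr do rewrite !linearD; rewrite big_split /= ey ez.
  by rewrite !linearD.
- under eq_bigr do rewrite !linearZ; rewrite -scaler_sumr /= ey.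
  by rewrite !linearZ.
Qed.

Definition power_series_monad : monad F :=
  @Monad F pser pser_map pser_mult pser_unit pser_map_id pser_map_comp
    pser_unit_natural pser_mult_natural pser_mult_unit pser_mult_map_unit
    pser_mult_assoc.

End PowerSeries.

Section Differential.
Variables (F : fieldType) (V : lmodType F).

Section Term.
Variable n : nat.
Implicit Types (v : n.+1.-tuple V) (j : 'I_n.+1).

Definition partial_tuple v j : n.+1.-tuple (V * V)%type :=
  [tuple of rcons [tuple (tnth v (fintype.lift j k), 0) | k < n] (0, tnth v j)].

Definition partial_term v : sympow (V * V)%type n.+1 :=
  \sum_(j < n.+1) sprod (partial_tuple v j).

Definition partial_in_place v j : n.+1.-tuple (V * V)%type :=
  [tuple if i == j then (0, tnth v i) else (tnth v i, 0) | i < n.+1].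

Lemma perm_partial_tuple v j : perm_eq (partial_tuple v j) (partial_in_place v j).
Proof.
pose b i : V * V := if i == j then (0, tnth v i) else (tnth v i, 0).
have -> : partial_in_place v j = map b (enum 'I_n.+1) :> seq _ by [].
have -> : partial_tuple v j = map b (rcons (map (fintype.lift j) (enum 'I_n)) j) :> seq _.
  rewrite map_rcons -map_comp /= {2}/b eqxx; congr rcons; apply: eq_map => k.
  by rewrite /= /b eq_sym (negPf (neq_lift j k)).
apply/perm_map/uniq_perm; last 2 first.
- exact: enum_uniq.
- move=> i; rewrite mem_enum mem_rcons inE.
  by case: (unliftP j i) => [k|] ->; rewrite ?eqxx // mem_map ?mem_enum ?orbT //;
    apply: lift_inj.
rewrite rcons_uniq map_inj_uniq ?enum_uniq ?andbT; last exact: lift_inj.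
by apply/mapP => -[k _ e]; have := neq_lift j k; rewrite -e eqxx.
Qed.

Lemma partial_termE v :
  partial_term v = \sum_(j < n.+1) sprod (partial_in_place v j).
Proof.
by apply: eq_bigr => j _; apply/sprod_perm_eq/perm_partial_tuple.
Qed.

Lemma partial_term_multilinear : multilinear partial_term.
Proof.
move=> v l a x y; rewrite !partial_termE scaler_sumr -big_split.
apply: eq_bigr => j _ /=.
pose p z : V * V := if l == j then (0, z) else (z, 0).
have E z : partial_in_place (tuple_upd v l z) j =
           tuple_upd (partial_in_place v j) l (p z).
  apply: eq_from_tnth => i; rewrite !tnth_mktuple /p.
  by have [->|_] := eqVneq i l.
have pL : p (a *: x + y) = a *: p x + p y.
  by rewrite /p; case: ifP => _; congr pair; rewrite /= scaler0 addr0.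
by rewrite !E pL sprod_multilinear.
Qed.

Lemma partial_term_symmetric : symmetric_fun partial_term.
Proof.
move=> v s; rewrite !partial_termE [RHS](reindex_inj (@perm_inj _ s)).
apply: eq_bigr => j _; rewrite -[RHS](sprod_symmetric _ s); congr sprod.
by apply: eq_from_tnth => i; rewrite !tnth_mktuple (inj_eq perm_inj).
Qed.

Definition partial_lift : {linear sympow V n.+1 -> sympow (V * V)%type n.+1} :=
  sym_lift partial_term_multilinear partial_term_symmetric.

Lemma partial_liftE v : partial_lift (sprod v) = partial_term v.
Proof. exact: sym_liftE. Qed.
End Term.

Lemma pser_partial_linear :
  linear (fun t : pser V => (fun n => partial_lift n (t n)) : pser (V * V)%type).
Proof. by move=> a x y; apply: dprodP => n; apply: linearP. Qed.

Definition pser_partial : {linear pser V -> pser (V * V)%type} :=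
  linear_map pser_partial_linear.
End Differential.

Arguments pser_partial {F} V.

(* Main.v *)
Require Import Defs.
From mathcomp Require Import all_boot ssralg.

Set Implicit Arguments.
Unset Strict Implicit.
Unset Printing Implicit Defensive.

Import GRing.Theory.
Local Open Scope ring_scope.

(** A monomial [v_1 ... v_n] is sent by the differential to the sum, over the
    positions [j], of the monomial in [V * V] whose [j]-th factor is [(0, v_j)]
    and whose other factors are [(v_i, 0)]: the factor of index [j] is marked.
    Marked factors live in the second summand, so the differential is a formal
    derivative, [V * V] holding points and tangent directions.

    Every axiom except the chain rule [dc.4] compares linear maps that act
    degree by degree, so it suffices to compare them on monomials, where each
    side is a sum over marked positions.  The functorial maps act factor by
    factor, and then the axioms say: the marked factor vanishes under the first
    projection ([dc.1]); a monomial is additive in its marked factor ([dc.2]);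
    a monomial of degree one has one position to mark ([dc.3]); marking twice
    and keeping only the part [(a, d)] of [((a, b), (c, d))] leaves the terms
    where both marks fall on the same factor ([dc.5]); and the interchange
    swaps the first mark with the second ([dc.6]).

    For [dc.4], the multiplication of the monad substitutes series for the
    factors of a monomial and multiplies them out in the ring of power series
    with constant term.  Extended to that ring by zero in degree zero, the
    differential is a derivation along the ring morphism induced by the first
    injection ([symser_partialM]).  Hence a product of [k] series is
    differentiated by summing over its factors ([symser_partial_prod]), which
    is what the copairing of the first injection and the differential does
    after one of the [k] factors has been marked ([partial_mult_lift]). *)

Section SymmetricPower.
Variables (F : fieldType) (V : lmodType F).

Lemma sprod_eq0 n (v : n.-tuple V) j : tnth v j = 0 -> sprod v = 0.
Proof.
move=> vj0.
have updj : tuple_upd v j 0 = v.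
  by apply: eq_from_tnth => i; rewrite tnth_mktuple; case: eqP => // ->.
(* Expanding the entry [-1 *: 0 + 0] gives [sprod v = - sprod v + sprod v]. *)
have := sprod_multilinear v j (-1) 0 0.
by rewrite scaleN1r oppr0 addr0 updj scaleN1r addNr.
Qed.

(** Keeping the marked factor in its place, rather than moving it to the end as
    the defining formula of the differential does, makes [mark] commute with
    maps applied entrywise and with concatenation; it also makes sense for
    [n = 0], where there is no position to mark. *)
Definition mark n (v : n.-tuple V) (j : 'I_n) : n.-tuple (V * V)%type :=
  [tuple if i == j then (0, tnth v i) else (tnth v i, 0) | i < n].

Lemma partial_lift_sprod n (v : n.+1.-tuple V) :
  partial_lift V n (sprod v) = \sum_(j < n.+1) sprod (mark v j).
Proof. by rewrite partial_liftE partial_termE. Qed.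

Lemma sym_map_partial (W : lmodType F) n (f : {linear (V * V)%type -> W})
    (v : n.+1.-tuple V) :
  sym_map f n.+1 (partial_lift V n (sprod v)) =
  \sum_(j < n.+1) sprod (map_tuple f (mark v j)).
Proof.
by rewrite partial_lift_sprod linear_sum; apply: eq_bigr => j _; apply: sym_mapE.
Qed.

End SymmetricPower.

Lemma partial_partial (F : fieldType) (V : lmodType F) n (v : n.+1.-tuple V) :
  partial_lift _ n (partial_lift _ n (sprod v)) =
  \sum_(j < n.+1) \sum_(l < n.+1) sprod (mark (mark v j) l).
Proof.
rewrite partial_lift_sprod linear_sum; apply: eq_bigr => j _.
exact: partial_lift_sprod.
Qed.

Section Monomials.
Variable F : fieldType.
Implicit Types V W : lmodType F.

Lemma partial_natural V W (f : {linear V -> W}) x :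
  pser_map (bi_map f f) (pser_partial V x) = pser_partial W (pser_map f x).
Proof.
apply: dprodP => n.
suff : lin_comp (sym_map (bi_map f f) n.+1) (partial_lift V n) =1
       lin_comp (partial_lift W n) (sym_map f n.+1) by apply.
apply: sympow_linear_eq => v /=.
rewrite sym_map_partial sym_mapE partial_lift_sprod.
apply: eq_bigr => j _; congr sprod; apply: eq_from_tnth => i.
by rewrite !(tnth_mktuple, tnth_map); case: ifP => _; congr pair; apply: linear0.
Qed.

(** The marked factor [(0, v_j)] projects to [0]. *)
Lemma partial_dc1 V x : pser_map (bi_proj0 V V) (pser_partial V x) = 0.
Proof.
apply: dprodP => n.
suff : lin_comp (sym_map (bi_proj0 V V) n.+1) (partial_lift V n) =1 \0 by apply.
apply: sympow_linear_eq => v /=; rewrite sym_map_partial big1 // => j _.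
by apply: (@sprod_eq0 _ _ _ _ j); rewrite tnth_map tnth_mktuple eqxx.
Qed.

(** The three tuples obtained from [mark v j] have the same entries off
    position [j], and their entries at [j] are the three terms of
    [(0, (v, v)) = (0, (v, 0)) + (0, (0, v))]; monomials are multilinear. *)
Lemma partial_dc2 V x :
  pser_map (bi_map (lin_id V) (bi_diag V)) (pser_partial V x) =
  pser_map (bi_map (lin_id V) (bi_inj0 V V)) (pser_partial V x) +
  pser_map (bi_map (lin_id V) (bi_inj1 V V)) (pser_partial V x).
Proof.
apply: dprodP => n; rewrite dprodDE.
pose m (f : {linear V -> (V * V)%type}) :=
  lin_comp (sym_map (bi_map (lin_id V) f) n.+1) (partial_lift V n).
suff : m (bi_diag V) =1 m (bi_inj0 V V) \+ m (bi_inj1 V V) by apply.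
apply: sympow_linear_eq => v /=; rewrite !sym_map_partial -big_split.
apply: eq_bigr => j _ /=.
(* Only the entries off [j] matter, and there the three maps agree. *)
pose w := map_tuple (bi_map (lin_id V) (bi_diag V)) (mark v j).
have updE (f : {linear V -> (V * V)%type}) :
    sprod (map_tuple (bi_map (lin_id V) f) (mark v j)) =
    sprod (tuple_upd w j (0, f (tnth v j))).
  congr sprod; apply: eq_from_tnth => i; rewrite !(tnth_mktuple, tnth_map).
  by case: eqP => [->|_] //; congr pair; rewrite /= !linear0.
rewrite !updE -[sprod (tuple_upd w j (0, bi_inj0 V V _))]scale1r.
rewrite -sprod_multilinear scale1r; congr (sprod (tuple_upd w j _)).
by congr pair; rewrite /= ?addr0 //; congr pair; rewrite /= ?addr0 ?add0r.
Qed.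

Lemma partial_dc3 V x :
  pser_partial V (pser_unit V x) = pser_unit (V * V)%type (bi_inj1 V V x).
Proof.
apply: dprodP => -[|n]; last exact: linear0.
rewrite [LHS]partial_lift_sprod big_ord1; congr sprod.
by apply: eq_from_tnth => i; rewrite tnth_mktuple (ord1 i).
Qed.

(** When the marks [j] and [l] differ, the factor [j] becomes
    [((0, v_j), (0, 0))], which is sent to [(0, 0)] and kills the monomial; when
    they agree it becomes [((0, 0), (0, v_j))], which is sent to [(0, v_j)]. *)
Lemma partial_dc5 V x :
  pser_map (bi_map (bi_proj0 V V) (bi_proj1 V V))
    (pser_partial (V * V)%type (pser_partial V x)) = pser_partial V x.
Proof.
apply: dprodP => n.
set f := bi_map _ _.
suff : lin_comp (sym_map f n.+1)
         (lin_comp (partial_lift (V * V)%type n) (partial_lift V n)) =1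
       partial_lift V n by apply.
apply: sympow_linear_eq => v /=; rewrite partial_partial partial_lift_sprod.
rewrite linear_sum; apply: eq_bigr => j _; rewrite linear_sum (bigD1 j) //=.
rewrite big1 ?addr0 => [|l nlj]; rewrite sym_mapE.
  congr sprod; apply: eq_from_tnth => i; rewrite !(tnth_mktuple, tnth_map).
  by case: eqP.
apply: (@sprod_eq0 _ _ _ _ j); rewrite !(tnth_mktuple, tnth_map) eqxx.
by rewrite eq_sym (negPf nlj).
Qed.

(** The interchange exchanges [((0, v), (0, 0))] and [((0, 0), (v, 0))], that
    is, the first mark and the second; it fixes the factors with both marks and
    those with none.  So it only permutes the terms of the double sum. *)
Lemma partial_dc6 V x :
  pser_map (bi_interchange V) (pser_partial (V * V)%type (pser_partial V x)) =
  pser_partial (V * V)%type (pser_partial V x).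
Proof.
apply: dprodP => n.
set dd := lin_comp (partial_lift (V * V)%type n) (partial_lift V n).
suff : lin_comp (sym_map (bi_interchange V) n.+1) dd =1 dd by apply.
apply: sympow_linear_eq => v /=; rewrite partial_partial [RHS]exchange_big.
rewrite linear_sum; apply: eq_bigr => j _; rewrite linear_sum.
apply: eq_bigr => l _; rewrite [LHS]sym_mapE.
congr sprod; apply: eq_from_tnth => i; rewrite !(tnth_mktuple, tnth_map).
by case: (i == j); case: (i == l).
Qed.

End Monomials.

Section ProductRule.
Variables (F : fieldType) (V : lmodType F).

(** Extending the differential by zero to degree [0], as the derivative of a
    constant, gives a map on the ring of all power series, where a product
    rule can be stated. *)
Definition sym_partial n : {linear sympow V n -> sympow (V * V)%type n} :=
  match n with 0%N => \0 | m.+1 => partial_lift V m end.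

Lemma sym_partial_sprod n (v : n.-tuple V) :
  sym_partial n (sprod v) = \sum_(j < n) sprod (mark v j).
Proof. by case: n v => [|n] v; [rewrite big_ord0 | apply: partial_lift_sprod]. Qed.

Lemma mark_lshift a b (u : a.-tuple V) (v : b.-tuple V) j :
  mark (cat_tuple u v) (lshift b j) =
  cat_tuple (mark u j) (map_tuple (bi_inj0 V V) v).
Proof.
apply: eq_from_tnth => i; rewrite tnth_mktuple.
case: (split_ordP i) => k ->; rewrite ?tnth_lshift ?tnth_rshift.
  by rewrite tnth_mktuple eq_lshift.
by rewrite eq_rlshift tnth_map.
Qed.

Lemma mark_rshift a b (u : a.-tuple V) (v : b.-tuple V) j :
  mark (cat_tuple u v) (rshift a j) =
  cat_tuple (map_tuple (bi_inj0 V V) u) (mark v j).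
Proof.
apply: eq_from_tnth => i; rewrite tnth_mktuple.
case: (split_ordP i) => k ->; rewrite ?tnth_lshift ?tnth_rshift.
  by rewrite eq_lrshift tnth_map.
by rewrite tnth_mktuple eq_rshift.
Qed.

(** The product rule on monomials: a mark on the concatenation of [u] and [v]
    falls either on [u] or on [v], and the unmarked part is embedded in [V * V]
    by the first injection. *)
Lemma sym_partial_hmul n a b (x : sympow V a) (y : sympow V b) :
  sym_partial n (hmul n x y) =
  hmul n (sym_partial a x) (sym_map (bi_inj0 V V) b y) +
  hmul n (sym_map (bi_inj0 V V) a x) (sym_partial b y).
Proof.
have [abn|/eqP abn] := eqVneq (a + b)%N n; last first.
  by rewrite !(hmul_neq _ _ abn) linear0 addr0.
elim/sympow_ind: x => [u||x1 x2 e1 e2|d x e].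
- elim/sympow_ind: y => [v||y1 y2 e1 e2|d y e].
  + case: n / abn; rewrite hmul_sprod (sprod_seq_tuple (cat_tuple u v)).
    rewrite !sym_mapE !sym_partial_sprod hmul_suml linear_sum big_split_ord.
    congr (_ + _); apply: eq_bigr => j _ /=; rewrite hmul_sprod.
      by rewrite mark_lshift -sprod_seq_tuple.
    by rewrite mark_rshift -sprod_seq_tuple.
  + by rewrite !linear0 addr0.
  + by rewrite !linearD /= e1 e2 addrACA.
  + by rewrite !linearZ /= e scalerDr.
- by rewrite !(linear0, hmul0l) addr0.
- by rewrite !(linearD, hmulDl) /= e1 e2 addrACA.
- by rewrite !(linearZ, hmulZl) /= e scalerDr.
Qed.

Definition symser_partial (x : symser V) : symser (V * V)%type :=
  fun n => sym_partial n (x n).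

Lemma symser_partialM x y :
  symser_partial (x * y) =
  symser_partial x * symser_map (bi_inj0 V V) y +
  symser_map (bi_inj0 V V) x * symser_partial y.
Proof.
apply: dprodP => n; rewrite dprodDE /symser_partial.
rewrite !(symser_mul_coefE _ _ (ltnSn n)) linear_sum -big_split.
apply: eq_bigr => i _ /=; rewrite linear_sum -big_split.
by apply: eq_bigr => j _; apply: sym_partial_hmul.
Qed.

Lemma symser_partial1 : symser_partial 1 = 0.
Proof.
apply: dprodP => -[|n] //; rewrite /symser_partial.
by rewrite -[(1 : symser V) _]/(sprod_seq _ [::]) sprod_seq_neq ?linear0.
Qed.

(** Iterated product rule.  The summand is a single product with a test on the
    index, rather than one factor times a product over the other indices, so
    that it has the shape of a marked monomial. *)
Lemma symser_partial_prod k (x : 'I_k -> symser V) :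
  symser_partial (\prod_(i < k) x i) =
  \sum_(j < k) \prod_(i < k)
    (if i == j then symser_partial (x i) else symser_map (bi_inj0 V V) (x i)).
Proof.
elim: k x => [|k IHk] x; first by rewrite !big_ord0 symser_partial1.
rewrite big_ord_recl symser_partialM symser_map_prod IHk [RHS]big_ord_recl.
rewrite mulr_sumr; congr (_ + _); first by rewrite big_ord_recl eqxx.
apply: eq_bigr => j _; rewrite big_ord_recl; congr (_ * _).
Qed.

Lemma symser_partial_incl t :
  symser_partial (pser_incl t) = pser_incl (pser_partial V t).
Proof. by apply: dprodP => -[|n]. Qed.

(** The chain rule for a monomial [s_1 ... s_k] of series.  On the left, the
    product rule differentiates one of the [s_i] at a time.  On the right, the
    copairing sends the marked factor [(0, s_j)] to the differential of [s_j]
    and an unmarked [(s_i, 0)] to the image of [s_i] under the first injection,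
    so the two sums agree term by term. *)
Lemma partial_mult_lift k n (x : sympow (pser V) k.+1) :
  partial_lift V n (mult_lift V k.+1 n.+1 x) =
  mult_lift (V * V)%type k.+1 n.+1
    (sym_map (bi_copair (pser_map (bi_inj0 V V)) (pser_partial V)) k.+1
       (partial_lift (pser V) k x)).
Proof.
set g := bi_copair _ _.
suff : lin_comp (partial_lift V n) (mult_lift V k.+1 n.+1) =1
  lin_comp (mult_lift (V * V)%type k.+1 n.+1)
    (lin_comp (sym_map g k.+1) (partial_lift (pser V) k)) by apply.
apply: sympow_linear_eq => s /=.
rewrite sym_map_partial mult_liftE mult_termE linear_sum.
rewrite -[LHS]/(symser_partial _ n.+1) symser_partial_prod dprod_sumE.
apply: eq_bigr => j _; rewrite [RHS]mult_liftE mult_termE.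
under eq_bigr => i _ do rewrite symser_partial_incl symser_map_incl.
congr (_ n.+1); apply: eq_bigr => i _; rewrite tnth_map tnth_mktuple.
case: ifP => _; congr pser_incl; rewrite [RHS]linear_mapE /= linear0.
  by rewrite add0r.
by rewrite addr0.
Qed.

Lemma partial_dc4 x :
  pser_partial V (pser_mult V x) =
  pser_mult (V * V)%type
    (pser_map (bi_copair (pser_map (bi_inj0 V V)) (pser_partial V))
       (pser_partial (pser V) x)).
Proof.
apply: dprodP => n; rewrite -[LHS]/(partial_lift V n _) !pser_multE linear_sum.
by apply: eq_bigr => k _; apply: partial_mult_lift.
Qed.
End ProductRule.

Theorem proposition5p2 (F : fieldType) :
  (forall (V : lmodType F) (t : pser V) (n m : nat) (v : 'I_m -> n.+1.-tuple V),
     t n = \sum_(i < m) sprod (v i) ->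
     pser_partial V t n =
       \sum_(i < m) \sum_(j < n.+1)
         sprod [tuple of rcons [tuple (tnth (v i) (fintype.lift j k), 0) | k < n]
                               (0, tnth (v i) j)]) /\
  differential_combinator_transformation (S := power_series_monad F)
    (fun V : lmodType F => pser_partial V).
Proof.
split=> [V t n m v tE|].
  rewrite -[LHS]/(partial_lift V n (t n)) tE linear_sum.
  by apply: eq_bigr => i _; apply: partial_liftE.
split.
- exact: partial_natural.
- exact: partial_dc1.
- exact: partial_dc2.
- exact: partial_dc3.
- exact: partial_dc4.
- exact: partial_dc5.
- exact: partial_dc6.
Qed.
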